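(* For any two integers $n\ge k\ge 1$ there exists a finite simple graph $G(n,k)$ with $\operatorname{reg}(G(n,k))=n$ and $\operatorname{im}(G(n,k))=k$.
   Context: $\operatorname{reg}(G)=\max\{j\ge0:\widetilde H_{j-1}(\operatorname{Ind}(G[S]);\Bbbk)\neq0\text{ for some }S\subseteq V(G)\}$ is the Castelnuovo–Mumford regularity of $R/I(G)$ for the edge ideal of $G$ ($\operatorname{Ind}$ = independence complex). $\operatorname{im}(G)$ is the induced matching number: the maximum size of a set of edges no two of which share a vertex or are joined by an edge of $G$. *)

(* Defs.v *)
From HB Require Import structures.
From mathcomp Require Import all_boot all_order all_algebra.
Set Implicit Arguments. Unset Strict Implicit. Unset Printing Implicit Defensive.
Import Order.TTheory GRing.Theory Num.Theory.

(* Graphs on vertex set 'I_m, given by an adjacency relation e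
   (simple = symmetric & irreflexive, imposed in the theorem). *)

Definition independent (m : nat) (e : rel 'I_m) (A : {set 'I_m}) : bool :=
  [forall x in A, forall y in A, ~~ e x y].

(* Faces of the independence complex Ind(G[S]) of the induced subgraph G[S]:
   independent sets of G contained in S. *)
Definition ind_face (m : nat) (e : rel 'I_m) (S : {set 'I_m}) : pred {set 'I_m} :=
  fun A => (A \subset S) && independent e A.

(* Simplicial boundary map of a complex P (predicate on faces) from the chain
   space spanned by faces of cardinality s (dimension s-1) to faces of
   cardinality s-1, acting on row vectors, written as a square matrix indexed
   by all subsets of 'I_m (entries vanish outside the relevant faces, which
   does not affect the rank).  Vertices are ordered by the order of 'I_m;
   the coefficient of sigma \ {v} in d(sigma) is (-1)^(#{u in sigma | u < v}).
   For s = 0 (the empty face) the map is 0 (augmented chain complex). *)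
Definition bdry (F : fieldType) (m : nat) (P : pred {set 'I_m}) (s : nat)
  : 'M[F]_#|{: {set 'I_m}}| :=
  \matrix_(i, j)
    (let sigma := enum_val i in
     let tau := enum_val j in
     if P sigma && (#|sigma| == s) then
       \sum_(v in sigma)
          ((tau == sigma :\ v)%:R * (-1) ^+ #|[set u in sigma | (u < v)%N]|)
     else 0)%R.

(* dim_F of the reduced homology  H~_{j-1}(P; F)  of the complex P:
   (#faces of cardinality j) - rank d_j - rank d_{j+1}. *)
Definition red_betti (F : fieldType) (m : nat) (P : pred {set 'I_m}) (j : nat) : nat :=
  #|[set A : {set 'I_m} | P A && (#|A| == j)]| - \rank (bdry F P j) - \rank (bdry F P j.+1).

Definition is_reg (F : fieldType) (m : nat) (e : rel 'I_m) (r : nat) : Prop :=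
  (exists S : {set 'I_m}, 0 < red_betti F (ind_face e S) r) /\
  (forall (j : nat) (S : {set 'I_m}), 0 < red_betti F (ind_face e S) j -> j <= r).

Definition is_edge (m : nat) (e : rel 'I_m) (f : {set 'I_m}) : bool :=
  [exists x, exists y, e x y && (f == [set x; y])].

Definition induced_matching (m : nat) (e : rel 'I_m) (M : {set {set 'I_m}}) : bool :=
  [forall f in M, is_edge e f] &&
  [forall f in M, forall g in M, (f != g) ==>
     [forall x in f, forall y in g, (x != y) && ~~ e x y]].

Definition is_im (m : nat) (e : rel 'I_m) (k : nat) : Prop :=
  (exists M, induced_matching e M /\ #|M| = k) /\
  (forall M, induced_matching e M -> #|M| <= k).

(* Main.v *)
(* Deleting a vertex lowers the regularity by at most one, so it is enough to
   find graphs of induced matching number 1 and arbitrarily large regularity: add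
   k - 1 disjoint edges to such a graph and delete vertices of its first part until
   the regularity drops to n; as n > k - 1, an edge of the first part survives.

   Gap-free graphs of large regularity come from a finite version of Osajda's
   construction.  Let G be gap-free with nonzero homology in Ind(G), and let W be the
   right-angled Coxeter group in which the generators of nonadjacent vertices of G
   commute.  Take a finite quotient Q of W and join g and h in Q when h = g s_A for an
   independent set A, s_A being the product of its generators.  The complement of this
   graph is gap-free as soon as Q detects the cancellations in products of four
   factors s_A, and for this the product of (Z/2)^V and of one copy of S_3 for each edge
   uv of G (s_u and s_v going to the two Coxeter generators) suffices.  Its independence
   complex contains the triangulated cubes g<s_A>.  Summing them with signs, over one
   triangulation per cube, gives a degree-one chain map from Ind(G); taking the link
   at the neutral element and sending s_A to min A is a left inverse up to
   sign, so the homology of Ind(G) embeds one degree higher. *)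
Require Import Defs.
From HB Require Import structures.
From mathcomp Require Import all_boot all_order all_algebra all_fingroup.
Set Implicit Arguments. Unset Strict Implicit. Unset Printing Implicit Defensive.
Import Order.TTheory GRing.Theory Num.Theory.

(** * Exterior algebra on the vertices: contraction, wedge and boundary *)

Notation chain F m := {ffun {set 'I_m} -> F^o}.

Section Exterior.
Local Open Scope ring_scope.
Variables (F : fieldType) (m : nat).
Implicit Types (c : chain F m) (A B : {set 'I_m}) (u v : 'I_m).

Definition sgn v A : F := (-1) ^+ #|[set u in A | (u < v)%N]|.

Lemma sgnD1 v u A : sgn v A = (-1) ^+ ((u \in A) && (u < v)%N) * sgn v (A :\ u).
Proof.
rewrite /sgn -exprD; congr (_ ^+ _).
rewrite (cardsD1 u) !inE; congr (_ + _)%N; apply: eq_card => x.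
by rewrite !inE andbA.
Qed.

Lemma sgnD1id v A : sgn v (A :\ v) = sgn v A.
Proof. by rewrite (sgnD1 v v A) ltnn andbF mul1r. Qed.

Lemma sgnU1 v u A : u \notin A -> sgn v (u |: A) = (-1) ^+ (u < v)%N * sgn v A.
Proof. by move=> uA; rewrite (sgnD1 v u) setU11 setU1K. Qed.

Lemma sgnU1id v A : sgn v (v |: A) = sgn v A.
Proof. by rewrite -sgnD1id -[in RHS]sgnD1id setDUl setDv set0U. Qed.

Lemma sgn_sq v A : sgn v A * sgn v A = 1.
Proof. by rewrite -expr2 sqrr_sign. Qed.

(* Chains are functions on all subsets; [contr v] and [wed v] are the contraction and the
   left multiplication by the vertex v in the exterior algebra on the vertices. *)
Definition contr v c : chain F m :=
  [ffun A : {set 'I_m} => if v \in A then 0 else sgn v A * c (v |: A)].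
Definition wed v c : chain F m :=
  [ffun A : {set 'I_m} => if v \in A then sgn v A * c (A :\ v) else 0].
Definition del c : chain F m := \sum_v contr v c.
Definition basis B : chain F m := [ffun A : {set 'I_m} => (A == B)%:R].

Fact contr_is_linear v : linear (contr v).
Proof.
move=> a c d; apply/ffunP=> A; rewrite !ffunE; case: ifP => _.
  by rewrite scaler0 addr0.
by rewrite /GRing.scale /= mulrDr mulrCA.
Qed.
HB.instance Definition _ v :=
  GRing.isLinear.Build F (chain F m) (chain F m) *:%R (contr v) (contr_is_linear v).

Fact wed_is_linear v : linear (wed v).
Proof.
move=> a c d; apply/ffunP=> A; rewrite !ffunE; case: ifP => _.
  by rewrite /GRing.scale /= mulrDr mulrCA.
by rewrite scaler0 addr0.
Qed.
HB.instance Definition _ v :=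
  GRing.isLinear.Build F (chain F m) (chain F m) *:%R (wed v) (wed_is_linear v).

Fact del_is_linear : linear del.
Proof.
move=> a c d; rewrite /del scaler_sumr -big_split /=.
by apply: eq_bigr => v _; rewrite linearP.
Qed.
HB.instance Definition _ :=
  GRing.isLinear.Build F (chain F m) (chain F m) *:%R del del_is_linear.

Lemma sgn_swap u v A : u != v -> u \in A -> v \in A ->
  sgn u A * sgn v (A :\ u) = - (sgn v A * sgn u (A :\ v)).
Proof.
move=> uv uA vA; rewrite (sgnD1 u v A) (sgnD1 v u A) uA vA /=.
rewrite -val_eqE in uv.
by case: ltngtP uv => //= _ _; rewrite ?expr0 ?expr1 ?mul1r ?mulN1r ?mulNr ?mulrN ?opprK mulrC.
Qed.

Lemma wed_anti u v c : wed u (wed v c) = - wed v (wed u c).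
Proof.
apply/ffunP=> A; rewrite !ffunE !inE.
have [->|uv] := eqVneq u v; first by case: ifP; rewrite /= ?mulr0 oppr0.
rewrite /=; case: ifP => uA; case: ifP => vA //;
  rewrite ?mulr0 ?oppr0 //.
by rewrite !mulrA sgn_swap // mulNr setDDl setUC -setDDl.
Qed.

Lemma wed_sq v c : wed v (wed v c) = 0.
Proof. by apply/ffunP=> A; rewrite !ffunE !inE eqxx /=; case: ifP; rewrite ?mulr0. Qed.

Lemma contr_anti u v c : contr u (contr v c) = - contr v (contr u c).
Proof.
apply/ffunP=> A; rewrite !ffunE !inE.
have [->|uv] := eqVneq u v; first by case: ifP; rewrite /= ?mulr0 oppr0.
rewrite /=; case: ifP => uA; case: ifP => vA //;
  rewrite ?mulr0 ?oppr0 //.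
rewrite !mulrA (setUCA [set v]) -mulNr; congr (_ * _).
rewrite !sgnU1 ?uA ?vA //; rewrite -val_eqE in uv.
by case: ltngtP uv => //= _ _; rewrite ?expr0 ?expr1 ?mul1r ?mulN1r ?mulNr ?mulrN ?opprK mulrC.
Qed.

Lemma contr_sq v c : contr v (contr v c) = 0.
Proof. by apply/ffunP=> A; rewrite !ffunE !inE eqxx /=; case: ifP; rewrite ?mulr0. Qed.

Lemma contr_wed u v c : u != v -> contr u (wed v c) = - wed v (contr u c).
Proof.
move=> uv; apply/ffunP=> A; rewrite !ffunE !inE [v == u]eq_sym (negPf uv) /=.
case: ifP => uA; case: ifP => vA //; rewrite ?andbF ?mulr0 ?oppr0 //.
have -> : u |: A :\ v = (u |: A) :\ v.
  by rewrite setDUl; congr (_ :|: _); apply/esym/setDidPl; rewrite disjoints1 inE.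
rewrite !mulrA -mulNr (sgnD1 u v A) vA sgnU1 ?uA //=; congr (_ * _); rewrite -val_eqE in uv.
by case: ltngtP uv => //= _ _; rewrite ?expr0 ?expr1 ?mul1r ?mulN1r ?mulNr ?mulrN ?opprK mulrC.
Qed.

Lemma contr_wedK v c : contr v (wed v c) = c - wed v (contr v c).
Proof.
apply/ffunP=> A; rewrite !ffunE !inE eqxx /=; case: ifP => vA.
  by rewrite setD1K // sgnD1id mulrA sgn_sq mul1r subrr.
by rewrite setU1K ?vA // sgnU1id mulrA sgn_sq mul1r subr0.
Qed.

(** Contractions at [u != v] anticommute with [wed v], and the one at [v] contributes the identity.
    So [wed v] is a contracting homotopy, which drives the cone argument and the inductions on
    simplices. *)
Lemma del_wed v c : del (wed v c) = c - wed v (del c).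
Proof.
rewrite /del (bigD1 v) //= contr_wedK linear_sum [X in _ = _ - X](bigD1 v) //=.
rewrite opprD addrA -sumrN; congr (_ + _).
by apply: eq_bigr => u uv; rewrite contr_wed.
Qed.

Lemma del_contr v c : del (contr v c) = - contr v (del c).
Proof. by rewrite /del linear_sum -sumrN; apply: eq_bigr => u _; rewrite contr_anti. Qed.

(** Pairing [(u, v)] with [(v, u)] cancels everything off the diagonal. The diagonal is a separate
    hypothesis because antisymmetry does not make it vanish in characteristic two. *)
Lemma antisym_sum0 (V : zmodType) (f : 'I_m -> 'I_m -> V) :
  (forall u, f u u = 0) -> (forall u v, f u v = - f v u) -> \sum_u \sum_v f u v = 0.
Proof.
move=> f0 fN.
have split_sum u : \sum_v f u v = \sum_(v : 'I_m | (u < v)%N) f u v + \sum_(v : 'I_m | (v < u)%N) f u v.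
  rewrite (bigID (fun v : 'I_m => (u < v)%N)) /=; congr (_ + _).
  rewrite (bigD1 u) ?ltnn //= f0 add0r; apply: eq_bigl => v.
  by rewrite -leqNgt ltn_neqAle andbC.
rewrite (eq_bigr _ (fun u _ => split_sum u)) big_split /= [X in _ + X](exchange_big_dep predT) //=.
rewrite -big_split big1 //= => u _; rewrite -big_split big1 //= => v _.
by rewrite (fN u v) addNr.
Qed.

Lemma del_del c : del (del c) = 0.
Proof.
rewrite {2}/del linear_sum /del exchange_big /=.
apply: antisym_sum0 => [u|u v]; [exact: contr_sq | exact: contr_anti].
Qed.

Lemma chain_basis c : c = \sum_A c A *: basis A.
Proof.
apply/ffunP=> A; rewrite sum_ffunE (bigD1 A) //= !ffunE eqxx big1 ?addr0.
  by rewrite /GRing.scale /= mulr1.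
by move=> B nAB; rewrite !ffunE eq_sym (negPf nAB) scaler0.
Qed.

Lemma wed_basis v A : v \notin A -> wed v (basis A) = sgn v A *: basis (v |: A).
Proof.
move=> vA; apply/ffunP=> B; rewrite !ffunE /GRing.scale /=; case: ifP => vB.
  have -> : (B :\ v == A) = (B == v |: A).
    by apply/eqP/eqP => [<-|->]; rewrite ?setD1K ?setU1K.
  by case: eqP => [->|]; rewrite ?sgnU1id ?mulr0.
by case: eqP vB => [->|]; rewrite ?setU11 ?mulr0.
Qed.

Lemma wed_basis0 v A : v \in A -> wed v (basis A) = 0.
Proof.
move=> vA; apply/ffunP=> B; rewrite !ffunE; case: ifP => // vB.
by case: eqP => [BA|]; rewrite ?mulr0 //; rewrite -BA !inE eqxx in vA.
Qed.

Lemma contr_basis v A : v \in A -> contr v (basis A) = sgn v A *: basis (A :\ v).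
Proof.
move=> vA; apply/ffunP=> B; rewrite !ffunE /GRing.scale /=; case: ifP => vB.
  by case: eqP vB => [->|]; rewrite ?mulr0 // !inE eqxx.
have -> : (v |: B == A) = (B == A :\ v).
  by apply/eqP/eqP => [<-|->]; rewrite ?setD1K ?setU1K ?vB.
by case: eqP => [->|]; rewrite ?sgnD1id ?mulr0.
Qed.

Lemma contr_basis0 v A : v \notin A -> contr v (basis A) = 0.
Proof.
move=> vA; apply/ffunP=> B; rewrite !ffunE; case: ifP => // vB.
by case: eqP => [BA|]; rewrite ?mulr0 //; rewrite -BA !inE eqxx in vA.
Qed.

Lemma basis_wed v A : v \in A -> basis A = sgn v A *: wed v (basis (A :\ v)).
Proof.
by move=> vA; rewrite wed_basis ?inE ?eqxx // scalerA sgnD1id sgn_sq scale1r setD1K.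
Qed.

(** Chains of all complexes live in one space; belonging to a given complex is a condition on the
    support. *)
Definition supp (P : {set 'I_m} -> Prop) c := forall A, c A != 0 -> P A.

Lemma suppW (P Q : {set 'I_m} -> Prop) c : (forall A, P A -> Q A) -> supp P c -> supp Q c.
Proof. by move=> PQ Pc A /Pc/PQ. Qed.

Lemma supp0 P : supp P 0.
Proof. by move=> A; rewrite ffunE eqxx. Qed.

Lemma suppD P c d : supp P c -> supp P d -> supp P (c + d).
Proof.
move=> Pc Pd A; rewrite ffunE; have [->|/Pc //] := eqVneq (c A) 0.
by rewrite add0r => /Pd.
Qed.

Lemma suppZ P a c : supp P c -> supp P (a *: c).
Proof.
by move=> Pc A; rewrite ffunE /GRing.scale /= mulf_eq0 negb_or => /andP[_ /Pc].
Qed.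

Lemma suppN P c : supp P c -> supp P (- c).
Proof. by move=> Pc A; rewrite ffunE oppr_eq0 => /Pc. Qed.

Lemma supp_sum P (I : finType) (Q : pred I) (g : I -> chain F m) :
  (forall i, Q i -> supp P (g i)) -> supp P (\sum_(i | Q i) g i).
Proof. by move=> Pg; apply: (big_ind (supp P)) => //; [exact: supp0 | exact: suppD]. Qed.

Lemma supp_basis (P : {set 'I_m} -> Prop) A : P A -> supp P (basis A).
Proof. by move=> PA B; rewrite ffunE; have [->|] := eqVneq B A; rewrite ?eqxx. Qed.

Lemma supp_contr (P Q : {set 'I_m} -> Prop) v c :
  supp P c -> (forall A, v \notin A -> P (v |: A) -> Q A) -> supp Q (contr v c).
Proof.
move=> Pc PQ A; rewrite ffunE; case: ifPn => [_|vA]; first by rewrite eqxx.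
by rewrite mulf_eq0 negb_or => /andP[_ /Pc/PQ]; apply.
Qed.

Lemma supp_wed (P Q : {set 'I_m} -> Prop) v c :
  supp P c -> (forall A, v \in A -> P (A :\ v) -> Q A) -> supp Q (wed v c).
Proof.
move=> Pc PQ A; rewrite ffunE; case: ifPn => [vA|_]; last by rewrite eqxx.
by rewrite mulf_eq0 negb_or => /andP[_ /Pc/PQ]; apply.
Qed.

Lemma supp_eq0 (P : {set 'I_m} -> Prop) c : supp P c -> (forall A, ~ P A) -> c = 0.
Proof.
move=> Pc nP; apply/ffunP=> A; rewrite ffunE; apply/eqP/negPn/negP => /Pc; exact: nP.
Qed.

Lemma contr_eq0 (P : {set 'I_m} -> Prop) v c :
  supp P c -> (forall A, v \notin A -> ~ P (v |: A)) -> contr v c = 0.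
Proof.
move=> Pc nP; apply/ffunP=> A; rewrite !ffunE; case: ifPn => // vA.
by have [->|/Pc/(nP _ vA)] := eqVneq (c (v |: A)) 0; rewrite ?mulr0.
Qed.

Lemma linear_ext (V : lmodType F) (f g : {linear chain F m -> V}) P c :
  supp P c -> (forall A, P A -> f (basis A) = g (basis A)) -> f c = g c.
Proof.
move=> Pc fg; rewrite [c]chain_basis !linear_sum; apply: eq_bigr => A _.
by rewrite !linearZ /=; have [->|/Pc/fg ->] := eqVneq (c A) 0; rewrite ?scale0r.
Qed.

End Exterior.

(** * Reduced homology *)

Section Homology.
Local Open Scope ring_scope.
Variables (F : fieldType) (m : nat).
Implicit Types (c : chain F m) (P : pred {set 'I_m}).

Definition face P s : pred {set 'I_m} := fun A => P A && (#|A| == s).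

(** The index [s] counts vertices, so the homology concerned is that of degree [s - 1]. *)
Definition acyclic P s :=
  forall z : chain F m, supp (face P s) z -> del z = 0 ->
  exists2 y : chain F m, supp (face P s.+1) y & del y = z.

Definition nonacyclic P s :=
  exists z : chain F m, [/\ supp (face P s) z, del z = 0 &
    forall y : chain F m, supp (face P s.+1) y -> del y <> z].

Let N := #|{: {set 'I_m}}|.
Definition vec c : 'rV[F]_N := \row_i c (enum_val i).

Fact vec_is_linear : linear vec.
Proof. by move=> a c d; apply/rowP=> i; rewrite !mxE !ffunE. Qed.
HB.instance Definition _ :=
  GRing.isLinear.Build F (chain F m) 'rV[F]_N *:%R vec vec_is_linear.

Lemma vec_inj : injective vec.
Proof.
move=> c d /rowP E; apply/ffunP=> A.
by have := E (enum_rank A); rewrite !mxE enum_rankK.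
Qed.

Definition unvec (w : 'rV[F]_N) : chain F m := [ffun A : {set 'I_m} => w 0 (enum_rank A)].

Lemma unvecK : cancel unvec vec.
Proof. by move=> w; apply/rowP=> i; rewrite !mxE ffunE enum_valK. Qed.

Lemma vec_basis B : vec (basis F B) = delta_mx 0 (enum_rank B).
Proof.
by apply/rowP=> i; rewrite !mxE ffunE /= -(inj_eq enum_rank_inj) enum_valK.
Qed.

Lemma row_bdry P s B :
  row (enum_rank B) (bdry F P s) = if face P s B then vec (del (basis F B)) else 0.
Proof.
apply/rowP=> j; rewrite !mxE enum_rankK /= -/(face P s B); case: ifP => _; last by rewrite mxE.
rewrite /vec mxE /del sum_ffunE [LHS]big_mkcond /=; apply: eq_bigr => v _.
case: ifPn => vB; last by rewrite contr_basis0 // ffunE.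
by rewrite contr_basis // !ffunE mulrC.
Qed.

Lemma vec_bdry P s c : supp (face P s) c -> vec c *m bdry F P s = vec (del c).
Proof.
move=> Pc; pose f := mulmxr (bdry F P s) \o vec.
apply: (@linear_ext _ _ _ f (vec \o @del F m) _ _ Pc) => B PB.
by rewrite /= vec_basis -rowE row_bdry PB.
Qed.

Lemma supp_del P s c : (forall A B : {set 'I_m}, A \subset B -> P B -> P A) ->
  supp (face P s.+1) c -> supp (face P s) (del c).
Proof.
move=> hP Pc; apply: supp_sum => v _; apply: (supp_contr Pc) => A vA.
rewrite /face cardsU1 vA /= add1n eqSS => /andP[PA ->].
by rewrite (hP _ _ _ PA) // subsetUr.
Qed.

(** Rank-nullity on the span of the faces makes the Betti number the codimension of the boundaries
    in the cycles, so it vanishes exactly when the two spaces coincide. *)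
Lemma red_betti_eq0 P s : (forall A B : {set 'I_m}, A \subset B -> P B -> P A) ->
  red_betti F P s == 0%N <-> acyclic P s.
Proof.
move=> hP; set T := [set A | face P s A].
pose f (i : 'I_#|T|) : 'I_N := enum_rank (enum_val i).
(* The kernel of the square matrix also contains the basis vectors of all other subsets;
   intersecting it with the row space of [A] leaves only chains of faces. *)
pose A : 'M[F]_(#|T|, N) := rowsub f 1%:M.
have rowA i : row i A = vec (basis F (enum_val i)).
  by rewrite row_rowsub vec_basis rowE mulmx1.
have freeA : row_free A.
  apply/row_freeP; exists A^T; apply/matrixP=> i j.
  rewrite !mxE (bigD1 (f i)) //= !mxE eqxx mul1r big1 ?addr0.
    by rewrite (inj_eq enum_rank_inj) (inj_eq enum_val_inj) eq_sym.
  by move=> k ki; rewrite !mxE eq_sym (negPf ki) mul0r.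
have subA c : (vec c <= A)%MS <-> supp (face P s) c.
  split=> [/submxP[w Ew] B cB|Pc].
    have : vec c 0 (enum_rank B) != 0 by rewrite mxE enum_rankK.
    rewrite Ew mxE; have [/existsP[k /eqP fk] _|/existsPn nk] :=
      boolP [exists k, f k == enum_rank B].
      by have := enum_valP k; rewrite inE (enum_rank_inj fk).
    by rewrite big1 ?eqxx // => k _; rewrite !mxE (negPf (nk k)) mulr0.
  rewrite [c]chain_basis linear_sum; apply: summx_sub => B _.
  rewrite linearZ /=; have [->|/Pc PB] := eqVneq (c B) 0; first by rewrite scale0r sub0mx.
  have BT : B \in T by rewrite inE.
  by rewrite scalemx_sub // -(enum_rankK_in BT BT) -rowA row_sub.
have rkA : \rank (A *m bdry F P s) = \rank (bdry F P s).
  apply/eqP; rewrite (mxrank_leqif_sup (submxMl _ _)).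
  apply/row_subP=> i; rewrite -(enum_valK i); have := row_bdry P s (enum_val i).
  case: ifP => [Pi Ei|_ ->]; last exact: sub0mx.
  rewrite Ei -(@vec_bdry P s); last exact: supp_basis.
  by apply: submxMr; apply/subA; exact: supp_basis.
have kerE c : (vec c <= A :&: kermx (bdry F P s))%MS <-> supp (face P s) c /\ del c = 0.
  rewrite sub_capmx; split=> [/andP[/subA Pc /sub_kermxP]|[Pc dc]].
    by rewrite vec_bdry // => dc; split=> //; apply: vec_inj; rewrite dc linear0.
  apply/andP; split; first exact/subA.
  by apply/sub_kermxP; rewrite vec_bdry // dc linear0.
have imE c : (vec c <= bdry F P s.+1)%MS <->
    exists2 y : chain F m, supp (face P s.+1) y & del y = c.
  split=> [/submxP[w Ew]|[y Py <-]]; last by rewrite -(vec_bdry Py) submxMl.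
  exists (\sum_(B | face P s.+1 B) unvec w B *: basis F B).
    by apply: supp_sum => B PB; apply: suppZ; exact: supp_basis.
  apply: vec_inj; rewrite Ew -[X in _ = X *m _]unvecK; set d := unvec w.
  rewrite [X in _ = vec X *m _]chain_basis.
  rewrite (linear_sum (@del F m)) !(linear_sum vec) mulmx_suml [LHS]big_mkcond /=.
  apply: eq_bigr => B _; rewrite !linearZ /= -scalemxAl vec_basis -rowE.
  by rewrite row_bdry; case: ifP => //; rewrite scaler0.
have im_ker : (bdry F P s.+1 <= A :&: kermx (bdry F P s))%MS.
  apply/row_subP=> i; rewrite -(unvecK (row i _)).
  have /imE[y Py <-] : (vec (unvec (row i (bdry F P s.+1))) <= bdry F P s.+1)%MS.
    by rewrite unvecK row_sub.
  by apply/kerE; split; [exact: supp_del | exact: del_del].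
have -> : red_betti F P s =
    (\rank (A :&: kermx (bdry F P s)) - \rank (bdry F P s.+1))%N.
  have := mxrank_mul_ker A (bdry F P s); rewrite rkA (eqP freeA) => rkE.
  by rewrite /red_betti -(addKn (\rank (bdry F P s)) (\rank (A :&: kermx (bdry F P s))%MS)) rkE.
rewrite subn_eq0 (geq_leqif (mxrank_leqif_sup im_ker)); split.
  move=> sub z Pz dz; apply/imE; apply: submx_trans sub.
  exact/kerE.
move=> ac; apply/row_subP=> i; rewrite -(unvecK (row i _)); apply/imE.
have [Pz dz] := (kerE (unvec (row i (A :&: kermx (bdry F P s))%MS))).1 ltac:(rewrite unvecK row_sub //).
exact: ac.
Qed.

Lemma nonacyclic_betti P s : (forall A B : {set 'I_m}, A \subset B -> P B -> P A) ->
  nonacyclic P s -> (0 < red_betti F P s)%N.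
Proof.
move=> hP [z [Pz dz nz]]; rewrite lt0n; apply/negP => /(red_betti_eq0 s hP) ac.
by have [y Py /(nz y Py)] := ac z Pz dz.
Qed.

End Homology.

(** * Independence complexes of induced subgraphs: cones and vertex deletion *)

Lemma independentP m (e : rel 'I_m) (A : {set 'I_m}) :
  reflect {in A &, forall x y, ~~ e x y} (independent e A).
Proof.
apply: (iffP forall_inP) => [iA x y xA yA|iA x xA].
  by move/forall_inP: (iA x xA); apply.
by apply/forall_inP => y yA; apply: iA.
Qed.

Lemma independentS m (e : rel 'I_m) (A B : {set 'I_m}) :
  A \subset B -> independent e B -> independent e A.
Proof.
move=> /subsetP AB /independentP iB; apply/independentP => x y /AB xB /AB yB.
exact: iB.
Qed.

Lemma ind_faceS m (e : rel 'I_m) (S A B : {set 'I_m}) :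
  A \subset B -> ind_face e S B -> ind_face e S A.
Proof.
by move=> AB /andP[BS iB]; rewrite /ind_face (subset_trans AB) ?(independentS AB).
Qed.

Section Induced.
Local Open Scope ring_scope.
Variables (F : fieldType) (m : nat) (e : rel 'I_m).
Hypotheses (es : symmetric e) (ei : irreflexive e).
Implicit Types (S A : {set 'I_m}) (v : 'I_m).

Lemma independentU1 v A : independent e A -> {in A, forall u, ~~ e u v} ->
  independent e (v |: A).
Proof.
move=> /independentP iA nA; apply/independentP => x y.
rewrite !inE => /predU1P[->|xA] /predU1P[->|yA]; first by rewrite ei.
- by rewrite es nA.
- exact: nA.
- exact: iA.
Qed.

(** Here [v] is a cone point, and wedging a cycle with [v] fills it. *)
Lemma acyclic_cone S v s : v \in S -> {in S, forall u, ~~ e u v} ->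
  acyclic F (ind_face e S) s.
Proof.
move=> vS nS z Pz dz; exists (wed v z); last by rewrite del_wed dz linear0 subr0.
apply: (supp_wed Pz) => A vA /andP[/andP[AS iA] /eqP cA].
have AS' : A \subset S by rewrite -(setD1K vA) subUset sub1set vS.
rewrite /face /ind_face AS' /= (cardsD1 v) vA cA eqxx andbT -(setD1K vA).
apply: independentU1 iA _ => u uA; apply: nS; exact: (subsetP AS).
Qed.

(** Mayer-Vietoris by hand: [contr v z] is a cycle in the link of [v], and a filling of it there
    moves [z] into the deletion of [v], where it bounds. *)
Lemma acyclic_deletion S v s : v \in S ->
  acyclic F (ind_face e (S :\ v)) s.+1 ->
  acyclic F (ind_face e [set u in S | (u != v) && ~~ e u v]) s ->
  acyclic F (ind_face e S) s.+1.
Proof.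
move=> vS acD acL z Pz dz.
have [||y Py dy] := acL (contr v z); last 1 first.
(* Since [del (wed v y)] is [y - wed v (contr v z)], adding it cancels exactly the terms of [z] that
   contain [v]. *)
- have Pz' : supp (face (ind_face e (S :\ v)) s.+1) (z + del (wed v y)).
    rewrite del_wed dy addrCA; apply: suppD.
      apply: suppW Py => A /andP[/andP[/subsetP AS iA] cA].
      rewrite /face /ind_face iA cA !andbT; apply/subsetP => u /AS.
      by rewrite !inE => /and3P[-> -> _].
    move=> A; rewrite !ffunE; case: ifPn => vA.
      by rewrite setD1K // !inE eqxx /= sgnD1id mulrA sgn_sq mul1r subrr eqxx.
    by rewrite subr0 => /Pz/andP[/andP[AS iA] cA]; rewrite /face /ind_face subsetD1 AS vA iA.
  have [|x Px dx] := acD _ Pz'; first by rewrite linearD /= dz del_del addr0.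
  exists (x - wed v y); last by rewrite linearB /= dx addrK.
  apply: suppD.
    apply: suppW Px => A /andP[/andP[AS iA] cA]; rewrite /face /ind_face iA cA !andbT.
    by apply: subset_trans AS _; rewrite subD1set.
  apply: suppN; apply: (supp_wed Py) => A vA /andP[/andP[/subsetP AS iA] /eqP cA].
  rewrite /face /ind_face (cardsD1 v) vA cA eqxx andbT -(setD1K vA); apply/andP; split.
    by rewrite subUset sub1set vS; apply/subsetP => u /AS; rewrite inE => /andP[].
  by apply: independentU1 iA _ => u /AS; rewrite !inE => /and3P[].
- apply: (supp_contr Pz) => A vA; rewrite /face /ind_face cardsU1 vA add1n eqSS.
  case/andP=> /andP[AS /independentP iA] ->; rewrite andbT; apply/andP; split; last first.
    by apply/independentP => x y xA yA; apply: iA; rewrite inE ?xA ?yA orbT.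
  apply/subsetP => u uA; rewrite inE (subsetP AS) ?inE ?uA ?orbT //=.
  rewrite (memPn vA) //= iA ?inE ?eqxx ?uA ?orbT //.
- by rewrite del_contr dz linear0 oppr0.
Qed.
End Induced.

(** * Simplicial maps *)

Section Push.
Local Open Scope ring_scope.
Variables (F : fieldType) (M m : nat) (f : 'I_M -> 'I_m).
Implicit Types (B : {set 'I_M}) (l : seq 'I_M).

(* The exterior product of the f x, for x in B, in the order of l. *)
Definition wedges l B : chain F m :=
  foldr (fun x d => if x \in B then wed (f x) d else d) (basis F set0) l.

(** The chain map induced by the vertex map [f]; a simplex on which [f] is not injective goes to
    zero because a repeated wedge factor vanishes. *)
Definition push (c : chain F M) : chain F m := \sum_B c B *: wedges (enum 'I_M) B.

Fact push_is_linear : linear push.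
Proof.
move=> a c d; rewrite /push scaler_sumr -big_split /=; apply: eq_bigr => B _.
by rewrite !ffunE scalerDl scalerA.
Qed.
HB.instance Definition _ :=
  GRing.isLinear.Build F (chain F M) (chain F m) *:%R push push_is_linear.

Lemma push_basis B : push (basis F B) = wedges (enum 'I_M) B.
Proof.
rewrite /push (bigD1 B) //= ffunE eqxx scale1r big1 ?addr0 // => A nAB.
by rewrite ffunE (negPf nAB) scale0r.
Qed.

Lemma push_basis0 : push (basis F set0) = basis F set0.
Proof. by rewrite push_basis /wedges; elim: (enum 'I_M) => //= x l ->; rewrite inE. Qed.

Lemma wed_wedges0 l B x : x \in l -> x \in B -> wed (f x) (wedges l B) = 0.
Proof.
elim: l => //= y l IH; rewrite inE => xyl xB.
have [xy|nxy] := eqVneq x y; first by rewrite -xy xB wed_sq.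
rewrite (negPf nxy) /= in xyl; case: ifP => _; rewrite ?IH //.
by rewrite wed_anti IH // linear0 oppr0.
Qed.

Lemma wedgesU1 l B x : x \notin l -> wedges l (x |: B) = wedges l B.
Proof.
elim: l => //= y l IH; rewrite inE negb_or => /andP[xy /IH ->].
by rewrite !inE eq_sym (negPf xy).
Qed.

(** Moving the factor [f x] to its place in [l] passes one factor for each earlier element of [B];
    by sortedness these are the smaller ones. *)
Lemma wed_wedges l B x : sorted (relpre val ltn) l -> x \in l -> x \notin B ->
  wed (f x) (wedges l B) =
  (-1) ^+ count (fun u : 'I_M => (u \in B) && (u < x)%N) l *: wedges l (x |: B).
Proof.
elim: l => //= y l IH lS; rewrite inE => xyl xB.
have tr : transitive (relpre val ltn : rel 'I_M) by move=> ? ? ?; apply: ltn_trans.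
have ylt z : z \in l -> (y < z)%N by move/(allP (order_path_min tr lS)).
have [xy|nxy] := eqVneq x y.
  have xl : x \notin l by apply/negP => /ylt; rewrite xy ltnn.
  rewrite -xy (negPf xB) setU11 (eq_in_count (a2 := pred0)) ?count_pred0 ?scale1r.
    by rewrite wedgesU1.
  by move=> u /ylt; rewrite -xy => xu; rewrite ltnNge ltnW ?andbF.
rewrite (negPf nxy) /= in xyl; rewrite !inE eq_sym (negPf nxy) /= ylt // andbT.
have {}IH := IH (path_sorted lS) xyl xB; case: ifP => yB /=; last by rewrite IH add0n.
by rewrite wed_anti IH linearZ /= exprS mulN1r scaleNr.
Qed.

Lemma push_wed x c : push (wed x c) = wed (f x) (push c).
Proof.
apply: (@linear_ext _ _ _ (push \o wed x) (wed (f x) \o push) (fun=> True) c) => // B _ /=.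
rewrite push_basis; have [xB|xB] := boolP (x \in B).
  by rewrite wed_basis0 // linear0 wed_wedges0 // mem_enum.
rewrite wed_basis // linearZ /= push_basis wed_wedges ?mem_enum //; last first.
  by rewrite -sorted_map val_enum_ord iota_ltn_sorted.
congr (_ ^+ _ *: _); rewrite cardE size_filter enumT; apply: eq_count => u; by rewrite !inE.
Qed.

Lemma basis_ind (P : {set 'I_M} -> Prop) : P set0 ->
  (forall x B, x \in B -> P (B :\ x) -> P B) -> forall B, P B.
Proof.
move=> P0 PU B; have [n] := ubnP #|B|; elim: n B => // n IH B.
have [->|[x xB]] := set_0Vmem B; first by [].
by rewrite (cardsD1 x) xB add1n ltnS => /IH; apply: PU.
Qed.

Lemma del_basis0 k : del (basis F (set0 : {set 'I_k})) = 0.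
Proof. by rewrite /del big1 // => v _; rewrite contr_basis0 ?inE. Qed.

Lemma push_del c : push (del c) = del (push c).
Proof.
apply: (@linear_ext _ _ _ (push \o @del F M) (@del F m \o push) (fun=> True) c) => // B _ /=.
elim/basis_ind: B => [|x B xB IH].
  by rewrite push_basis0 !del_basis0 linear0.
rewrite (basis_wed F xB) !linearZ /= push_wed !del_wed linearB /= push_wed IH.
by [].
Qed.

Lemma supp_push B :
  supp (fun A => (A \subset f @: B) && (#|A| == #|B|)) (push (basis F B)).
Proof.
elim/basis_ind: B => [|x B xB IH].
  by rewrite push_basis0; apply: supp_basis; rewrite sub0set !cards0.
rewrite (basis_wed F xB) linearZ /= push_wed; apply: suppZ; apply: (supp_wed IH) => A xA.
case/andP=> /subsetP AB /eqP cA; rewrite (cardsD1 x B) xB -cA (cardsD1 (f x)) xA eqxx andbT.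
apply/subsetP => u uA; have [->|ux] := eqVneq u (f x); first exact: imset_f.
have /imsetP[z] : u \in f @: (B :\ x) by apply: AB; rewrite !inE ux.
by rewrite inE => /andP[_ zB] ->; apply: imset_f.
Qed.

End Push.

Section PushMore.
Local Open Scope ring_scope.
Variables (F : fieldType) (M m : nat).

Lemma supp_pushP (f : 'I_M -> 'I_m) (P : {set 'I_M} -> Prop) (Q : {set 'I_m} -> Prop)
    (c : chain F M) : supp P c ->
  (forall (A : {set 'I_m}) B, P B -> A \subset f @: B -> #|A| = #|B| -> Q A) -> supp Q (push f c).
Proof.
move=> Pc PQ; rewrite /push; apply: supp_sum => B _.
have [->|cB] := eqVneq (c B) 0; first by rewrite scale0r; apply: supp0.
rewrite -push_basis; apply: suppZ; apply: suppW (@supp_push F M m f B).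
by move=> A /andP[AB /eqP cA]; apply: PQ (Pc _ cB) AB cA.
Qed.

Lemma pushK (f : 'I_M -> 'I_m) (g : 'I_m -> 'I_M) (c : chain F M) :
  cancel f g -> push g (push f c) = c.
Proof.
move=> fK.
apply: (@linear_ext F M _ (push g \o push f) idfun (fun=> True) c) => // B _ /=.
elim/basis_ind: B => [|x B xB IH]; first by rewrite !push_basis0.
by rewrite (basis_wed F xB) !linearZ /= !push_wed IH fK.
Qed.

End PushMore.

(** A filling of the image cycle would be pushed back along the retraction [g] to a filling of the
    original one. *)
Lemma nonacyclic_embed (F : fieldType) (M m : nat) (e : rel 'I_M) (e' : rel 'I_m) (f : 'I_M -> 'I_m)
    (g : 'I_m -> 'I_M) s : cancel f g -> (forall x y, e' (f x) (f y) = e x y) ->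
  nonacyclic F (ind_face e setT) s -> nonacyclic F (ind_face e' (f @: setT)) s.
Proof.
move=> fK fe [z [Pz dz nz]]; exists (push f z); split.
- apply: (supp_pushP Pz) => A B /andP[/andP[_ /independentP iB] /eqP <-] AB cA.
  rewrite /face /ind_face cA eqxx (subset_trans AB) ?imsetS ?subsetT //= andbT.
  apply/independentP => x y /(subsetP AB)/imsetP[x' x'B ->] /(subsetP AB)/imsetP[y' y'B ->].
  by rewrite fe iB.
- by rewrite -push_del dz linear0.
move=> y Py dy; apply: (nz (push g y)); last by rewrite -push_del dy pushK.
apply: (supp_pushP Py) => A B /andP[/andP[BT /independentP iB] /eqP <-] AB cA.
rewrite /face /ind_face cA eqxx subsetT /= andbT.
apply/independentP => u v /(subsetP AB)/imsetP[u' u'B ->] /(subsetP AB)/imsetP[v' v'B ->].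
rewrite -fe.
have /imsetP[u'' _ u''E] := subsetP BT _ u'B; have /imsetP[v'' _ v''E] := subsetP BT _ v'B.
by rewrite u''E v''E !fK -u''E -v''E iB.
Qed.

(** * Suspending a cycle over a group of reflections *)

Section Cube.
Local Open Scope ring_scope.
Variables (F : fieldType) (m M : nat) (act : 'I_M -> 'I_m -> 'I_M).
Implicit Types (q x : 'I_M) (u v w : 'I_m) (c : chain F m).

(* For a basis chain A of cardinality n, the sum over the orderings a_1, ..., a_n of A of the
   signed simplices q, q a_1, ..., q a_1 ... a_n triangulating the cube spanned by A at q. *)
Fixpoint cube n q c : chain F M :=
  if n is n'.+1 then wed q (\sum_v cube n' (act q v) (contr v c))
  else c set0 *: wed q (basis F set0).

Lemma cubeS n q c : cube n.+1 q c = wed q (\sum_v cube n (act q v) (contr v c)).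
Proof. by []. Qed.

Fact cube_is_linear n q : linear (cube n q).
Proof.
elim: n q => [|n IH] q a c d /=; first by rewrite !ffunE scalerDl scalerA.
rewrite -linearP /= scaler_sumr -big_split; congr (wed q _).
by apply: eq_bigr => v _; rewrite linearP IH.
Qed.
HB.instance Definition _ n q :=
  GRing.isLinear.Build F (chain F m) (chain F M) *:%R (cube n q) (cube_is_linear n q).

Arguments cube : simpl never.

Lemma cube_wed n q c : exists y, cube n q c = wed q y.
Proof. by case: n => [|n]; [exists (c set0 *: basis F set0); rewrite linearZ | eexists]. Qed.

Lemma supp_cube n q c (D : {set 'I_m}) (K : {set 'I_M}) :
  (forall x v, x \in K -> v \in D -> act x v \in K) -> q \in K ->
  supp (fun A => A \subset D) c ->
  supp (fun B => (B \subset K) && (#|B| == n.+1)) (cube n q c).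
Proof.
move=> KD; elim: n q c => [|n IH] q c qK Pc; rewrite /cube -/cube.
  apply: suppZ; apply: (@supp_wed _ _ (fun B => B == set0)); first exact: supp_basis.
  move=> B qB /eqP B0; rewrite (cardsD1 q) qB B0 cards0 andbT.
  by rewrite -(setD1K qB) B0 setU0 sub1set.
apply: (supp_wed (P := fun B => (B \subset K) && (#|B| == n.+1))) => [|B qB /andP[BK cB]].
  apply: supp_sum => v _; have [vD|vD] := boolP (v \in D).
    apply: IH; first exact: KD.
    by apply: (supp_contr Pc) => A _ AD; exact: subset_trans (subsetUr _ _) AD.
  have -> : contr v c = 0.
    apply: (contr_eq0 Pc) => A _ /subsetP AD.
    by case/negP: vD; apply: AD; rewrite setU11.
  by rewrite linear0; apply: supp0.
by rewrite (cardsD1 q) qB (eqP cB) eqxx andbT -(setD1K qB) subUset sub1set qK.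
Qed.

Variables (e : rel 'I_m).
Hypothesis actC : forall q u v, ~~ e u v -> act (act q u) v = act (act q v) u.

Lemma supp_contr_indep v c : supp (independent e) c -> supp (independent e) (contr v c).
Proof. by move=> ic; apply: (supp_contr ic) => A _; apply: independentS; apply: subsetUr. Qed.

(** The boundary consists of the far faces minus the near faces; the inner walls of the
    triangulation cancel in pairs. *)
Lemma del_cube n q c : supp (independent e) c ->
  del (cube n.+1 q c) =
  \sum_v cube n (act q v) (contr v c) - \sum_v cube n q (contr v c).
Proof.
elim: n q c => [|n IH] q c ic; rewrite cubeS del_wed; congr (_ - _).
  rewrite /cube (linear_sum (@del F M)) /= (linear_sum (wed q)) /=; apply: eq_bigr => v _.
  by rewrite !linearZ /= del_wed del_basis0 linear0 subr0.
rewrite [LHS](_ : _ = wed q (\sum_v \sum_u (cube n (act (act q v) u) (contr u (contr v c))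
    - cube n (act q v) (contr u (contr v c))))); last first.
  rewrite (linear_sum (@del F M)); congr (wed q _); apply: eq_bigr => v _.
  by rewrite sumrB; apply: IH; apply: supp_contr_indep.
rewrite [X in wed q X](_ : _ = \sum_v \sum_u cube n (act q v) (contr v (contr u c))).
  by rewrite exchange_big linear_sum.
under eq_bigr => v _ do rewrite sumrB.
rewrite sumrB antisym_sum0 ?sub0r.
- rewrite -sumrN; apply: eq_bigr => v _; rewrite -sumrN; apply: eq_bigr => u _.
  by rewrite -linearN contr_anti opprK.
- by move=> u; rewrite contr_sq linear0.
(* For nonadjacent [u], [v] the end point does not depend on the order while the contractions
   anticommute; adjacent vertices share no independent set, so both terms vanish. *)
move=> u v; have [euv|/actC ->] := boolP (e u v); last by rewrite contr_anti linearN.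
have zero w w' : e w w' || e w' w -> contr w (contr w' c) = 0.
  move=> ww'; apply/ffunP=> A; rewrite !ffunE; case: ifP => //; case: ifP; rewrite ?mulr0 //.
  move=> _ _; have [->|/ic/independentP iA] := eqVneq (c (w' |: (w |: A))) 0; first by rewrite !mulr0.
  by case/orP: ww'; apply/contraTeq => _; apply: iA; rewrite !inE eqxx ?orbT.
by rewrite !zero ?euv ?orbT // !linear0 ?oppr0.
Qed.

Variable (par : 'I_M -> 'I_m -> bool) (o : 'I_M).
Hypothesis actK : forall q v, act (act q v) v = q.
Hypothesis par_act : forall q v u, par (act q v) u = par q u (+) (u == v).
Hypothesis par_o : forall v, par o v = false.

(** The sign character of the reflection group, taking the value -1 on each generator. *)
Definition eps q : F := \prod_v (-1) ^+ par q v.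

Lemma eps_act q v : eps (act q v) = - eps q.
Proof.
rewrite /eps (bigD1 v) //= [in RHS](bigD1 v) //= par_act eqxx addbT -mulNr; congr (_ * _).
  by case: (par q v); rewrite ?expr0 ?expr1 ?opprK.
by apply: eq_bigr => u /negPf uv; rewrite par_act uv addbF.
Qed.

Lemma eps_o : eps o = 1.
Proof. by rewrite /eps big1 // => v _; rewrite par_o. Qed.

(* Keeps the faces A for which q is the corner with all A-coordinates zero, so that each cube is
   counted once in [suspend]: counting every corner would multiply by 2^n, which may vanish. *)
Definition lower q c : chain F m :=
  [ffun A : {set 'I_m} => if [forall v in A, ~~ par q v] then c A else 0].

Lemma supp_lower q c (P : {set 'I_m} -> Prop) : supp P c ->
  supp (fun A => P A /\ {in A, forall v, ~~ par q v}) (lower q c).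
Proof.
move=> Pc A; rewrite ffunE; case: ifP => [/forall_inP nA /Pc PA|]; last by rewrite eqxx.
by split.
Qed.

(** Exactly one of [q] and [act q v] has [v]-coordinate zero, and it keeps the faces through [v]. *)
Lemma contr_lower q v c : contr v (lower (act q v) c) + contr v (lower q c) = lower q (contr v c).
Proof.
apply/ffunP=> A; rewrite !ffunE; case: ifPn => vA; first by rewrite addr0 if_same.
have sub q' : [forall u in v |: A, ~~ par q' u] = ~~ par q' v && [forall u in A, ~~ par q' u].
  apply/forall_inP/andP => [nA|[nv /forall_inP nA] u].
    split; first by apply: nA; rewrite setU11.
    by apply/forall_inP => u uA; apply: nA; rewrite setU1r.
  by rewrite !inE => /predU1P[->|/nA].
have -> : [forall u in v |: A, ~~ par (act q v) u] = par q v && [forall u in A, ~~ par q u].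
  rewrite sub par_act eqxx addbT negbK; congr (_ && _); apply: eq_forallb_in => u uA.
  by rewrite par_act (_ : u == v = false) ?addbF //; apply: contraNF vA => /eqP <-.
by rewrite sub; case: (par q v) => /=; case: ifP => _; rewrite ?mulr0 ?addr0 ?add0r.
Qed.

Definition suspend n c : chain F M := \sum_q eps q *: cube n q (lower q c).

(** Reindexing the far faces in direction [v] by [act^~ v] flips [eps], so they get the same sign as
    the near faces; [contr_lower] then adds the two halves. *)
Lemma del_suspend n c : supp (independent e) c ->
  del (suspend n.+1 c) = - suspend n (del c).
Proof.
move=> ic; rewrite /suspend linear_sum.
have il q : supp (independent e) (lower q c).
  by apply: (suppW _ (supp_lower (q := q) ic)) => A [].
under eq_bigr => q _ do rewrite linearZ /= del_cube // scalerBr !scaler_sumr.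
rewrite sumrB exchange_big [X in _ - X]exchange_big /= -sumrB.
transitivity (- \sum_v \sum_q eps q *: cube n q (lower q (contr v c))); last first.
  rewrite exchange_big; congr (- _); apply: eq_bigr => q _.
  rewrite -scaler_sumr -linear_sum; congr (_ *: cube _ _ _).
  apply/ffunP=> A; rewrite !ffunE /del !sum_ffunE; case: ifP => An.
    by apply: eq_bigr => v _; rewrite ffunE An.
  by rewrite big1 // => v _; rewrite ffunE An.
rewrite -sumrN; apply: eq_bigr => v _.
have bij : {on predT, bijective (act^~ v)} by apply: onW_bij; exists (act^~ v) => q; rewrite actK.
rewrite (reindex _ bij) -sumrB -sumrN; apply: eq_bigr => q _ /=.
by rewrite eps_act actK scaleNr -opprD -scalerDr -linearD contr_lower.
Qed.

(** Every vertex of a cube other than its corner [q] has a flipped coordinate in the spanning face,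
    so such an [x] is not a vertex of the cube. *)
Lemma contr_cube0 n x q c : x != q ->
  supp (fun A => {in A, forall v, par x v = par q v}) c -> contr x (cube n q c) = 0.
Proof.
elim: n q c => [|n IH] q c xq Pc; rewrite /cube -/cube.
  by rewrite linearZ /= contr_wed // contr_basis0 ?inE // linear0 oppr0 scaler0.
rewrite contr_wed // linear_sum big1 ?linear0 ?oppr0 // => v _.
have [pv|pv] := eqVneq (par x v) (par q v).
  apply: IH.
    by apply: contra_eq_neq pv => ->; rewrite par_act eqxx addbT; case: par.
  apply: (supp_contr Pc) => A vA PA u uA; rewrite par_act (_ : u == v = false) ?addbF.
    by apply: PA; rewrite setU1r.
  by apply: contraNF vA => /eqP <-.
rewrite (_ : contr v c = 0) ?linear0 //.
apply: (contr_eq0 Pc) => A _ PA.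
by case/eqP: pv; apply: PA; rewrite setU11.
Qed.

(** On a face kept by [lower q] the coordinates of [q] agree with those of [o], so by [contr_cube0]
    only the cubes with corner [o] contain [o]. *)
Lemma contr_suspend n c :
  contr o (suspend n.+1 c) = \sum_v cube n (act o v) (contr v c).
Proof.
rewrite /suspend (linear_sum (contr o)) (bigD1 o) //= [X in _ + X]big1 => [|q qo]; last first.
  rewrite linearZ /= contr_cube0 ?scaler0 1?eq_sym //.
  have Tc : supp (fun=> True) c by [].
  by apply: (suppW _ (supp_lower (q := q) Tc)) => A [_ nA] v /nA/negPf ->; rewrite par_o.
have -> : lower o c = c.
  by apply/ffunP=> A; rewrite ffunE; case: forall_inP => // nA; case: nA => v _; rewrite par_o.
rewrite eps_o scale1r addr0 cubeS contr_wedK (linear_sum (contr o)) [X in wed o X]big1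
  ?linear0 ?addr0 // => v _.
apply: contr_cube0.
  by apply/eqP => /(congr1 (par^~ v)); rewrite par_act eqxx par_o.
apply: (@supp_contr _ _ (fun=> True)) => // A vA _ u uA.
by rewrite par_act !par_o; apply/esym; apply: contraNF vA => /eqP <-.
Qed.

Variable f : 'I_M -> 'I_m.
Hypothesis fP : forall q w, par q w -> (forall u, par q u -> (w <= u)%N) -> f q = w.

(** Invariant of the decreasing walk through a cube: what remains to be flipped lies below all that
    is flipped already. *)
Definition lowest (A : {set 'I_m}) q := {in A, forall v u, par q u -> (v < u)%N}.

(* Along a simplex q, q a_1, ..., q a_1 ... a_n the least element of the support must change at each
   step for the image to be nondegenerate: only the decreasing ordering of A survives. *)
Lemma push_cube_out n q (A : {set 'I_m}) u a : #|A| = n -> a \in A -> (u < a)%N -> par q u ->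
  {in A, forall v, ~~ par q v} -> push f (cube n q (basis F A)) = 0.
Proof.
elim: n q A u a => [|n IH] q A u a cA aA ua qu nA; first by rewrite (cards0_eq cA) inE in aA.
wlog qmin : u ua qu / forall w, par q w -> (u <= w)%N.
  move=> W; case: (arg_minnP (fun w : 'I_m => w : nat) qu) => w qw wmin.
  by apply: (W w) => //; apply: leq_ltn_trans ua; apply: wmin.
rewrite cubeS push_wed (fP qu qmin) (linear_sum (push f)) linear_sum big1 // => v _.
have [vA|vA] := boolP (v \in A); last by rewrite contr_basis0 // !linear0.
rewrite contr_basis // !linearZ /=.
have nqv := nA v vA.
have cAv : #|A :\ v| = n by move: cA; rewrite (cardsD1 v) vA => -[].
have uv : u != v by apply: contraTneq qu => ->.
have [vu|uv' ] := ltnP v u.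
  rewrite (IH _ _ v a) ?linear0 ?scaler0 //.
  - by rewrite !inE aA andbT; apply: contraTneq vu => <-; rewrite -leqNgt ltnW.
  - exact: ltn_trans vu ua.
  - by rewrite par_act eqxx addbT.
  - move=> w; rewrite !inE => /andP[/negPf wv wA]; rewrite par_act wv addbF; exact: nA.
have [y ->] := cube_wed n (act q v) (basis F (A :\ v)).
rewrite push_wed (fP (w := u)) ?wed_sq ?scaler0 ?par_act ?(negPf uv) ?addbF //.
by move=> w; rewrite par_act; have [->|_] := eqVneq w v; rewrite ?addbF //; move/qmin.
Qed.

(** Only [max A] contributes: after flipping another [v], the larger [max A] remains to be flipped,
    and [push_cube_out] applies. *)
Lemma push_cubes n q (A : {set 'I_m}) : #|A| = n.+1 -> lowest A q ->
  (forall v, v \in A -> lowest (A :\ v) (act q v) ->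
    push f (cube n (act q v) (basis F (A :\ v))) = wed v (basis F (A :\ v))) ->
  \sum_v push f (cube n (act q v) (contr v (basis F A))) = basis F A.
Proof.
move=> cA lowA IH; have /card_gt0P[a0 a0A] : (0 < #|A|)%N by rewrite cA.
case: (arg_maxnP (fun w : 'I_m => w : nat) a0A) => a aA amax.
have nA : {in A, forall v, par q v = false}.
  by move=> v vA; apply/negP => /(lowA v vA); rewrite ltnn.
rewrite (bigD1 a) //= [X in _ + X]big1 ?addr0 => [|v va].
  rewrite contr_basis // !linearZ /= IH //; first by rewrite -basis_wed.
  move=> v; rewrite !inE => /andP[va vA] u; rewrite par_act.
  have [-> _|_] := eqVneq u a; last by rewrite addbF; apply: lowA.
  by rewrite ltn_neqAle val_eqE va; apply: amax.
have [vA|vA] := boolP (v \in A); last by rewrite contr_basis0 // !linear0.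
rewrite contr_basis // !linearZ /= (@push_cube_out n _ _ v a) ?scaler0 //.
- by move: cA; rewrite (cardsD1 v) vA => -[].
- by rewrite !inE eq_sym va.
- by rewrite ltn_neqAle val_eqE va; apply: amax.
- by rewrite par_act eqxx nA.
- by move=> w; rewrite !inE par_act => /andP[/negPf -> wA]; rewrite nA.
Qed.

Lemma push_cube n q (A : {set 'I_m}) u : #|A| = n -> lowest A q -> par q u ->
  (forall w, par q w -> (u <= w)%N) -> push f (cube n q (basis F A)) = wed u (basis F A).
Proof.
elim: n q A u => [|n IH] q A u cA lowA qu qmin.
  by rewrite (cards0_eq cA) /cube linearZ /= ffunE eqxx scale1r push_wed push_basis0 (fP qu qmin).
rewrite cubeS push_wed (fP qu qmin) (linear_sum (push f)) push_cubes // => v vA low'.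
apply: IH => //.
- by move: cA; rewrite (cardsD1 v) vA => -[].
- by rewrite par_act eqxx addbT; apply/negP => /(lowA v vA); rewrite ltnn.
move=> w; rewrite par_act; have [->|_] := eqVneq w v; first by [].
by rewrite addbF => /(lowA v vA)/ltnW.
Qed.

Lemma push_contr_suspend n c : supp (fun A => #|A| == n.+1) c ->
  push f (contr o (suspend n.+1 c)) = c.
Proof.
move=> cn; rewrite contr_suspend.
pose h (d : chain F m) := \sum_v push f (cube n (act o v) (contr v d)).
have h_lin : linear h.
  move=> k d d'; rewrite /h scaler_sumr -big_split; apply: eq_bigr => v _.
  by rewrite !linearP.
pose H := GRing.isLinear.Build F (chain F m) (chain F m) *:%R h h_lin.
pose hL : {linear chain F m -> chain F m} := HB.pack h H.
rewrite (linear_sum (push f)).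
apply: (@linear_ext _ _ _ hL idfun _ _ cn) => A /eqP cA /=.
apply: push_cubes => // [v _ u|v vA lowv]; first by rewrite par_o.
apply: push_cube => //; first by move: cA; rewrite (cardsD1 v) vA => -[].
- by rewrite par_act eqxx par_o.
by move=> w; rewrite par_act par_o /= => /eqP ->.
Qed.

(** Two requirements on the new graph: the cubes are faces of its independence complex, and [f] maps
    the link of [o] simplicially to that of [e]. *)
Variable e' : rel 'I_M.
Hypothesis cube_face : forall q (A : {set 'I_m}), independent e A ->
  exists K : {set 'I_M}, [/\ q \in K, forall x v, x \in K -> v \in A -> act x v \in K &
    independent e' K].
Hypothesis link_face : forall x y, x != o -> y != o -> ~~ e' o x -> ~~ e' o y -> ~~ e' x y ->
  ~~ e (f x) (f y).

Lemma supp_suspend n c : supp (independent e) c ->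
  supp (face (ind_face e' setT) n.+1) (suspend n c).
Proof.
move=> ic; apply: supp_sum => q _; apply: suppZ.
rewrite [lower q c]chain_basis (linear_sum (cube n q)); apply: supp_sum => A _.
rewrite linearZ /=; have [->|] := eqVneq (lower q c A) 0; first by rewrite scale0r; apply: supp0.
rewrite ffunE; case: ifP => [_ /ic iA|]; last by rewrite eqxx.
have [K [qK closedK iK]] := cube_face q iA.
apply: suppZ; apply: (suppW _ (supp_cube (n := n) closedK qK (supp_basis (subxx A)))).
move=> B /andP[BK /eqP cB].
by rewrite /face /ind_face subsetT (independentS BK iK) cB eqxx.
Qed.

Lemma nonacyclic_suspend n : nonacyclic F (ind_face e setT) n.+1 ->
  nonacyclic F (ind_face e' setT) n.+2.
Proof.
case=> z [Pz dz nz].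
have iz : supp (independent e) z by apply: (suppW _ Pz) => A /andP[/andP[]].
exists (suspend n.+1 z); split; first exact: supp_suspend.
  rewrite del_suspend // dz /suspend big1 ?oppr0 // => q _.
  by rewrite (_ : lower q 0 = 0) ?linear0 ?scaler0 //; apply/ffunP=> A; rewrite !ffunE if_same.
(* The link at [o] of a filling of the suspension is pushed to a filling of [z]; the minus sign
   compensates [del_contr]. *)
move=> y Py dy; apply: (nz (- push f (contr o y))).
  apply: suppN; apply: (@supp_pushP _ _ _ _ (fun B => independent e' (o |: B) /\
    o \notin B /\ #|B| = n.+2)).
    apply: (supp_contr Py) => A oA /andP[/andP[_ ->]].
    by rewrite cardsU1 oA add1n eqSS => /eqP ->.
  move=> A B [/independentP iB [oB cB]] AB cAB.
  rewrite /face /ind_face subsetT cAB cB eqxx andbT; apply/independentP => u v.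
  case/(subsetP AB)/imsetP=> x xB -> /(subsetP AB)/imsetP[x' xB' ->].
  by apply: link_face; rewrite ?(memPn oB) ?iB // !inE ?xB ?xB' ?eqxx ?orbT.
rewrite linearN /= -push_del del_contr dy (linearN (push f)) opprK /= push_contr_suspend //.
by apply: (suppW _ Pz) => A /andP[].
Qed.

End Cube.

(** * Gap-free graphs of large regularity *)

(** In a symmetric graph this excludes induced pairs of disjoint edges; if the two edges share a
    vertex, one of them is among the four alternatives. *)
Definition gap_free (T : Type) (e : rel T) :=
  forall x y z w, e x y -> e z w -> [|| e x z, e x w, e y z | e y w].

Section Thickening.
Local Open Scope group_scope.
Variables (m : nat) (e : rel 'I_m).
Hypotheses (es : symmetric e) (ei : irreflexive e) (eg : gap_free e).
Implicit Types (A B : {set 'I_m}) (u v w : 'I_m).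

(** Elements of the full product group. The copies of S_3 are indexed by all ordered pairs, and
    [letter] is trivial at the non-edges. *)
Definition state := ({ffun 'I_m -> bool} * {ffun 'I_m * 'I_m -> 'S_3})%type.
Implicit Types (x y z : state).

Let i1 : 'I_3 := @Ordinal 3 1 isT.
Definition swap01 : 'S_3 := tperm ord0 i1.
Definition swap12 : 'S_3 := tperm i1 ord_max.

(** The component at [p] of the product of the generators in [A]. An independent [A] contains at
    most one end of an edge, so the order of the tests is immaterial. *)
Definition letter A (p : 'I_m * 'I_m) : 'S_3 :=
  if e p.1 p.2 then if p.1 \in A then swap01 else if p.2 \in A then swap12 else 1 else 1.

Definition shift A x : state :=
  ([ffun v => x.1 v (+) (v \in A)], [ffun p => x.2 p * letter A p]).

Definition symdiff A B := (A :\: B) :|: (B :\: A).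

Lemma in_symdiff A B v : (v \in symdiff A B) = (v \in A) (+) (v \in B).
Proof. by rewrite !inE; case: (v \in A); case: (v \in B). Qed.

Lemma symdiff_sub A B : symdiff A B \subset A :|: B.
Proof. by apply/subsetP => v; rewrite in_symdiff !inE; case: (v \in A); case: (v \in B). Qed.

(** The product of the two transpositions has order three, so its square is not trivial. Parity
    alone cannot see this word. *)
Lemma swap_word : swap01 * swap12 * swap01 * swap12 != 1.
Proof.
apply/eqP => /permP/(_ ord0).
by rewrite !permM perm1 /swap01 /swap12 tpermL tpermL [tperm ord0 _ _]tpermD // tpermR.
Qed.

(** The generators in [A :|: B] are commuting involutions, so the common ones cancel. *)
Lemma shift_shift A B x : independent e (A :|: B) -> shift B (shift A x) = shift (symdiff A B) x.
Proof.
move=> /independentP iAB; congr (_, _); apply/ffunP; [move=> v|case=> u v].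
  by rewrite !ffunE in_symdiff addbA.
rewrite !ffunE /= -mulgA; congr (_ * _).
rewrite /letter /= !in_symdiff; case: ifPn => euv; last by rewrite mulg1.
have nboth : ~~ ((u \in A :|: B) && (v \in A :|: B)).
  by apply/negP => /andP[uAB vAB]; move: (iAB u v uAB vAB); rewrite euv.
move: nboth; rewrite !inE; case: (u \in A); case: (u \in B); case: (v \in A);
  case: (v \in B) => //= _; rewrite ?mulg1 ?mul1g ?tperm2 //.
Qed.

Lemma shift0 x : shift set0 x = x.
Proof.
case: x => x1 x2; congr (_, _); apply/ffunP=> i; rewrite !ffunE /letter ?inE ?addbF //.
by case: ifP; rewrite mulg1.
Qed.

Lemma shiftK A x : independent e A -> shift A (shift A x) = x.
Proof.
move=> iA; rewrite shift_shift ?setUid // (_ : symdiff A A = set0) ?shift0 //.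
by rewrite /symdiff setDv setU0.
Qed.

Definition near x y := [exists A, independent e A && (y == shift A x)].

Lemma nearP x y : reflect (exists2 A, independent e A & y = shift A x) (near x y).
Proof.
apply: (iffP existsP) => [[A /andP[iA /eqP ->]]|[A iA ->]]; exists A => //.
by rewrite iA eqxx.
Qed.

Lemma near_sym : symmetric near.
Proof.
suff sub x y : near x y -> near y x by move=> x y; apply/idP/idP; apply: sub.
by case/nearP => A iA ->; apply/nearP; exists A; rewrite ?shiftK.
Qed.

Lemma near_refl x : near x x.
Proof.
by apply/nearP; exists set0; rewrite ?shift0 //; apply/independentP => u v; rewrite inE.
Qed.

Lemma near_two x A B : independent e (A :|: B) -> near x (shift B (shift A x)).
Proof.
move=> iAB; apply/nearP; exists (symdiff A B); last exact: shift_shift.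
exact: independentS (symdiff_sub A B) iAB.
Qed.

(* Adjacent s and t never share a set, and by parity each of them occurs an even number of times in
   a, b, c, d: one occurs in a and the other in b, so the pattern is s t s t or s t t s, and S_3
   excludes the first. *)
Lemma quad_letters (a b c d : {set 'I_m}) s t :
  independent e a -> independent e b -> independent e c -> independent e d ->
  (forall v, (v \in a) (+) (v \in b) (+) (v \in c) (+) (v \in d) = false) ->
  (forall p, letter a p * letter b p * letter c p * letter d p = 1) ->
  s \in a -> t \in b -> e s t -> (s \in d) && (t \in c).
Proof.
move=> /independentP ia /independentP ib /independentP ic /independentP id par word sa tb est.
have sb : (s \in b) = false by apply: contraTF est => sb; apply: ib.
have ta : (t \in a) = false by apply: contraTF est => ta; apply: ia.
have nc : ~~ ((s \in c) && (t \in c)) by apply: contraL est => /andP[]; apply: ic.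
have nd : ~~ ((s \in d) && (t \in d)) by apply: contraL est => /andP[]; apply: id.
have := par s; have := par t; have := word (s, t).
rewrite /letter /= est sa sb ta tb; move: nc nd.
case: (s \in c); case: (t \in c); case: (s \in d); case: (t \in d) => //= _ _ W.
by case/eqP: swap_word.
Qed.

(** A gap would be a closed walk x, z, y, w through near pairs with both diagonals missing; its
    letters [a], [b], [c], [d] multiply to the identity. *)
Lemma near_gap_free : gap_free (fun x y => ~~ near x y).
Proof.
move=> x y z w nxy nzw; rewrite -!negb_and; apply/and4P => -[].
rewrite (near_sym x w) (near_sym y z) => /nearP[a ia zE] /nearP[d id xE] /nearP[b ib yE] /nearP[c ic wE].
have par v : (v \in a) (+) (v \in b) (+) (v \in c) (+) (v \in d) = false.
  have /(congr1 (fun s : state => s.1 v)) := xE.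
  rewrite wE yE zE !ffunE; case: (x.1 v); case: (v \in a); case: (v \in b);
    by case: (v \in c); case: (v \in d).
have word p : letter a p * letter b p * letter c p * letter d p = 1.
  have /(congr1 (fun s : state => s.2 p)) := xE.
  by rewrite wE yE zE !ffunE -[LHS]mulg1 -!mulgA => /mulgI.
(* The relation is rotated cyclically so that [quad_letters] can also start at [b]. *)
have par' v : (v \in b) (+) (v \in c) (+) (v \in d) (+) (v \in a) = false.
  by rewrite -[RHS](par v) -!addbA [RHS]addbC !addbA.
have word' p : letter b p * letter c p * letter d p * letter a p = 1.
  apply: (mulgI (letter a p)); rewrite mulg1 !mulgA word mul1g //.
have mixed A B : independent e A -> independent e B ->
    independent e (A :|: B) \/ exists s t, [/\ s \in A, t \in B & e s t].
  move=> /independentP iA /independentP iB.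
  have [|] := boolP [forall s in A, forall t in B, ~~ e s t].
    move=> /forall_inP H; left; apply/independentP => s t; rewrite !inE.
    have HH s' t' : s' \in A -> t' \in B -> ~~ e s' t' by move=> /H/forall_inP; apply.
    by case/orP=> sA /orP[] tA; [exact: iA | exact: HH | rewrite es; exact: HH | exact: iB].
  rewrite negb_forall_in => /exists_inP[s sA]; rewrite negb_forall_in => /exists_inP[t tB].
  by rewrite negbK => est; right; exists s, t.
(* If both chords are missing, the edges s t and u v form a gap in G. *)
have [iab|[s [t [sa tb est]]]] := mixed a b ia ib.
  by case/negP: nxy; rewrite yE zE near_two.
have [ibc|[u [v [ub vc euv]]]] := mixed b c ib ic.
  by case/negP: nzw; rewrite wE yE near_two.
have /andP[sd tc] := quad_letters ia ib ic id par word sa tb est.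
have /andP[ua vd] := quad_letters ib ic id ia par' word' ub vc euv.
(* Each of the four possible edges would join two elements of one of the independent sets [a], [d],
   [b], [c]. *)
case/or4P: (eg est euv); apply/negP.
- by move/independentP: ia; apply.
- by move/independentP: id; apply.
- by move/independentP: ib; apply.
- by move/independentP: ic; apply.
Qed.

Definition origin : state := ([ffun=> false], [ffun=> 1]).

(** The three sets satisfy: [b] is the symmetric difference of [a] and [c]. Adjacent [u] in [a] and
    [v] in [b] would both lie in [c]. *)
Lemma near_cliques x y u v : near origin x -> near origin y -> near x y ->
  x.1 u -> y.1 v -> ~~ e u v.
Proof.
case/nearP=> a /independentP ia -> /nearP[b /independentP ib ->] /nearP[c /independentP ic E].
have par w : (w \in b) = (w \in a) (+) (w \in c).
  by have /(congr1 (fun s : state => s.1 w)) := E; rewrite !ffunE.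
rewrite !ffunE /= => ua vb; apply/negP => euv.
have ub : (u \in b) = false by apply: contraTF euv => ub; apply: ib.
have va : (v \in a) = false by apply: contraTF euv => va; apply: ia.
have := par u; have := par v; rewrite ub va ua vb /= => /esym vc /esym/negbFE uc.
by move/negP: (ic _ _ uc vc).
Qed.

Variables (F : fieldType) (v0 : 'I_m).
Let M := #|{: state}|.
Let act (q : 'I_M) v : 'I_M := enum_rank (shift [set v] (enum_val q)).
Let par (q : 'I_M) v := (enum_val q).1 v.
(** The default [v0] is reached only when no coordinate of [q] is flipped. *)
Let first (q : 'I_M) : 'I_m :=
  odflt v0 [pick v | par q v && [forall u, par q u ==> (v <= u)%N]].
Definition thick : rel 'I_M := fun p q => ~~ near (enum_val p) (enum_val q).

Lemma thick_sym : symmetric thick.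
Proof. by move=> p q; rewrite /thick near_sym. Qed.

Lemma thick_irrefl : irreflexive thick.
Proof. by move=> p; rewrite /thick near_refl. Qed.

Lemma thick_gap_free : gap_free thick.
Proof. by move=> p q r s; apply: near_gap_free. Qed.

Lemma independent1 v : independent e [set v].
Proof. by apply/independentP => x y; rewrite !inE => /eqP -> /eqP ->; rewrite ei. Qed.

Lemma firstP q w : par q w -> (forall u, par q u -> (w <= u)%N) -> first q = w.
Proof.
move=> qw wmin; rewrite /first; case: pickP => [v /andP[qv /forall_inP vmin]|/(_ w)] /=.
  by apply/val_inj/eqP; rewrite eqn_leq vmin // wmin.
by rewrite qw /= => /forall_inP; case.
Qed.

Lemma first_par q : q != enum_rank origin -> near origin (enum_val q) -> par q (first q).
Proof.
move=> qo /nearP[a ia qE].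
have [a0|[v va]] := set_0Vmem a.
  by case/eqP: qo; rewrite -(enum_valK q) qE a0 shift0.
have qv : par q v by rewrite /par qE !ffunE va.
case: (arg_minnP (fun w : 'I_m => w : nat) qv) => w qw wmin.
by rewrite (firstP qw wmin).
Qed.

Lemma nonacyclic_thick n : nonacyclic F (ind_face e setT) n.+1 ->
  nonacyclic F (ind_face thick setT) n.+2.
Proof.
apply: (@nonacyclic_suspend F m M act e _ par (enum_rank origin) _ _ _ first).
- move=> q u v nuv; rewrite /act !enum_rankK; congr enum_rank.
  have iuv : independent e ([set u] :|: [set v]).
    apply/independentP => x y; rewrite !inE.
    by move=> /orP[]/eqP -> /orP[]/eqP ->; rewrite ?ei // es.
  rewrite !shift_shift //; last by rewrite setUC.
  by rewrite /symdiff setUC.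
- by move=> q v; rewrite /act enum_rankK shiftK ?enum_valK // independent1.
- by move=> q v u; rewrite /par /act enum_rankK !ffunE inE.
- by move=> v; rewrite /par enum_rankK ffunE.
- exact: firstP.
(* The vertices of the cube at [q] are its translates by all subsets of [A]; any two differ by such
   a translation. *)
- move=> q A iA; exists [set q' | [exists B : {set 'I_m},
    (B \subset A) && (enum_val q' == shift B (enum_val q))]].
  split.
  + by rewrite inE; apply/existsP; exists set0; rewrite sub0set shift0 eqxx.
  + move=> x v; rewrite !inE => /existsP[B /andP[BA /eqP xE]] vA; apply/existsP.
    have BvA : B :|: [set v] \subset A by rewrite subUset BA sub1set.
    exists (symdiff B [set v]); rewrite (subset_trans (symdiff_sub _ _)) //=.
    by rewrite /act enum_rankK xE shift_shift // (independentS BvA).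
  apply/independentP => x y; rewrite !inE negbK.
  move=> /existsP[B /andP[BA /eqP xE]] /existsP[C /andP[CA /eqP yE]].
  have -> : enum_val y = shift C (shift B (enum_val x)).
    by rewrite yE xE shiftK // (independentS BA).
  by apply: near_two; apply: independentS iA; rewrite subUset BA.
move=> x y xo yo; rewrite /thick !negbK !enum_rankK => nx ny nxy.
by apply: (near_cliques nx ny nxy); apply: first_par.
Qed.

End Thickening.

Section Base.
Local Open Scope ring_scope.
Variable F : fieldType.

Lemma gap_free_nonacyclic n : exists (m : nat) (e : rel 'I_m),
  [/\ (0 < m)%N, symmetric e, irreflexive e, gap_free e & nonacyclic F (ind_face e setT) n.+1].
Proof.
elim: n => [|n [m [e [m0 es ei eg en]]]].
  (* The base graph is a single edge: its independence complex is two points, and their difference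
     is a cycle without filling. *)
  exists 2, (fun x y => x != y); split=> //.
  - by move=> x y; rewrite eq_sym.
  - by move=> x; rewrite eqxx.
  - by move=> x y z w _; have [->|] := eqVneq x z => //= ->.
  pose i0 : 'I_2 := ord0; pose i1 : 'I_2 := ord_max.
  exists (basis F [set i0] - basis F [set i1]); split.
  - have s1 i : supp (face (ind_face (fun x y : 'I_2 => x != y) setT) 1) (basis F [set i]).
      apply: supp_basis; rewrite /face /ind_face subsetT cards1 /= andbT.
      by apply/independentP => x y; rewrite !inE => /eqP -> /eqP ->; rewrite eqxx.
    by apply: suppD => //; apply: suppN.
  - have d1 i : del (basis F [set i : 'I_2]) = basis F set0.
      rewrite (basis_wed F (set11 i)) linearZ /= setDv del_wed del_basis0 linear0 subr0.
      rewrite /sgn (_ : [set u in [set i] | (u < i)%N] = set0) ?cards0 ?scale1r //.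
      by apply/setP => u; rewrite !inE; case: eqP => // ->; rewrite ltnn.
    by rewrite linearB /= !d1 subrr.
  move=> y Py; rewrite (supp_eq0 Py) => [/ffunP/(_ [set i0])|A].
    rewrite linear0 !ffunE eqxx (_ : [set i0] == [set i1] = false) ?subr0.
      by move/eqP; rewrite eq_sym oner_eq0.
    by apply/eqP => /setP/(_ i0); rewrite !inE.
  case/andP=> /andP[_ /independentP iA] /cards2P[x [z [xz AE]]].
  by have := iA x z; rewrite AE !inE !eqxx orbT /= xz => /(_ isT isT).
exists #|{: state m}|, (thick e); split.
- by apply/card_gt0P; exists (origin m).
- exact: thick_sym.
- exact: thick_irrefl.
- exact: thick_gap_free.
exact: nonacyclic_thick (Ordinal m0) _ en.
Qed.
End Base.

Lemma ind_betti_eq0 F m (e : rel 'I_m) (S : {set 'I_m}) s :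
  red_betti F (ind_face e S) s == 0 <-> acyclic F (ind_face e S) s.
Proof. by apply: red_betti_eq0 => A B; apply: ind_faceS. Qed.

Lemma betti_acyclic F m (e : rel 'I_m) (S : {set 'I_m}) s :
  0 < red_betti F (ind_face e S) s -> ~ acyclic F (ind_face e S) s.
Proof. by rewrite lt0n => /negP n0 /ind_betti_eq0. Qed.

Lemma eq_red_betti (F : fieldType) m (P Q : pred {set 'I_m}) s :
  P =1 Q -> red_betti F P s = red_betti F Q s.
Proof.
move=> PQ; have bE t : bdry F P t = bdry F Q t by apply/matrixP=> i j; rewrite !mxE /= PQ.
by rewrite /red_betti !bE; congr (_ - _ - _); apply: eq_card => A; rewrite !in_set PQ.
Qed.

(** * Regularity under vertex deletion *)

Section Support.
Variables (F : fieldType) (m : nat) (e : rel 'I_m).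
Hypotheses (es : symmetric e) (ei : irreflexive e).
Implicit Types D S : {set 'I_m}.

(** The largest such [j] is the regularity of the subgraph induced on [D]. *)
Definition hom_in D j :=
  [exists S : {set 'I_m}, (S \subset D) && (0 < red_betti F (ind_face e S) j)].

Lemma hom_in_deletion D v j : hom_in D j.+1 -> hom_in (D :\ v) j.+1 || hom_in (D :\ v) j.
Proof.
case/existsP=> S /andP[SD bS].
have [vS|vS] := boolP (v \in S); last first.
  by apply/orP; left; apply/existsP; exists S; rewrite subsetD1 SD vS.
apply: contraTT bS; rewrite negb_or -leqNgt leqn0 => /andP[/existsPn nD /existsPn nL].
apply/ind_betti_eq0; apply: (acyclic_deletion es ei vS).
- apply/ind_betti_eq0; have := nD (S :\ v).
  by rewrite setSD //= -leqNgt leqn0.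
apply/ind_betti_eq0.
have := nL [set u in S | (u != v) && ~~ e u v].
rewrite (_ : _ \subset _) /= -?leqNgt ?leqn0 //.
by apply/subsetP => u; rewrite !inE => /and3P[/(subsetP SD) -> ->].
Qed.

(** Here [D'] covers the edges inside [D]. Deleting it vertex by vertex lowers the regularity by at
    most one each time and ends in an edgeless graph. *)
Lemma hom_in_bound (D D' : {set 'I_m}) j :
  {in D :\: D' &, forall u v, ~~ e u v} -> hom_in D j -> j <= #|D'|.
Proof.
have [k] := ubnP #|D'|; elim: k D D' j => // k IH D D' [//|j] cD' nD hD.
have [D'0|[v vD']] := set_0Vmem D'.
  rewrite D'0 setD0 in nD; case/existsP: hD => S /andP[SD /betti_acyclic[]].
  (* For empty [S] the only face is the empty one, too small for the positive index; otherwise every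
     vertex is a cone point. *)
  have [->|[v vS]] := set_0Vmem S.
    move=> z Pz _; exists 0%R; first exact: supp0.
    rewrite linear0 (supp_eq0 Pz) // => A; rewrite /face /ind_face subset0.
    by case/andP=> /andP[/eqP -> _]; rewrite cards0.
  apply: (acyclic_cone es ei vS) => u uS.
  by apply: nD; apply: (subsetP SD).
move: cD'; rewrite (cardsD1 v D') vD' add1n ltnS => cD'.
have nDv : {in (D :\ v) :\: (D' :\ v) &, forall u w, ~~ e u w}.
  have sub : (D :\ v) :\: (D' :\ v) \subset D :\: D'.
    by apply/subsetP => u; rewrite !inE; case: (u == v); rewrite ?andbF.
  by move=> u w /(subsetP sub) uD /(subsetP sub) wD; apply: nD.
by case/orP: (hom_in_deletion v hD) => /(IH _ _ _ cD' nDv) // /leq_trans; apply.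
Qed.

(* Deleting the vertices outside D by making them isolated: an isolated vertex is a cone point, so it
   carries no homology and does not affect the regularity. *)
Definition restr D : rel 'I_m := fun x y => [&& e x y, x \in D & y \in D].

Lemma restr_sym D : symmetric (restr D).
Proof. by move=> x y; rewrite /restr es; congr (_ && _); rewrite andbC. Qed.

Lemma restr_irrefl D : irreflexive (restr D).
Proof. by move=> x; rewrite /restr ei. Qed.

Lemma is_reg_restr D r : hom_in D r -> (forall j, hom_in D j -> j <= r) ->
  is_reg F (restr D) r.
Proof.
have restrE S j : S \subset D ->
    red_betti F (ind_face (restr D) S) j = red_betti F (ind_face e S) j.
  move=> SD; apply: eq_red_betti => A; rewrite /ind_face; case: (boolP (A \subset S)) => //= AS.
  have AD : {subset A <= D} by move=> u /(subsetP AS)/(subsetP SD).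
  by apply/independentP/independentP => iA x y xA yA;
    have := iA x y xA yA; rewrite /restr !AD // !andbT.
move=> /existsP[S /andP[SD bS]] ub; split; first by exists S; rewrite restrE.
move=> j T bT; have [TD|/subsetPn[v vT vD]] := boolP (T \subset D).
  by apply: ub; apply/existsP; exists T; rewrite TD -restrE.
case/betti_acyclic: bT; apply: (acyclic_cone (@restr_sym D) (@restr_irrefl D) vT) => u _.
by rewrite /restr (negPf vD) !andbF.
Qed.

End Support.

(** * Induced matchings of graphs whose color classes are gap-free *)

Section Colored.
Variables (m : nat) (C : finType) (col : 'I_m -> C) (e : rel 'I_m).
Hypothesis e_col : forall x y, e x y -> col x = col y.
Hypothesis e_gap : forall x y z w, e x y -> e z w -> col x = col z ->
  [|| e x z, e x w, e y z | e y w].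

(** One edge from each class gives an induced matching, and two matching edges of the same color
    would form a gap. *)
Lemma is_im_colored (p q : C -> 'I_m) :
  (forall c, e (p c) (q c)) -> (forall c, col (p c) = c) -> is_im e #|C|.
Proof.
move=> epq colp; have colq c : col (q c) = c by rewrite -(e_col (epq c)) colp.
pose g c := [set p c; q c].
have colg c x : x \in g c -> col x = c by rewrite !inE => /orP[]/eqP ->.
have g_inj : injective g.
  by move=> c d gcd; rewrite -(colp c); apply: colg; rewrite -gcd !inE eqxx.
split.
  exists (g @: setT); rewrite card_imset // cardsT; split=> //; apply/andP; split.
    apply/forall_inP => _ /imsetP[c _ ->]; apply/existsP; exists (p c); apply/existsP.
    by exists (q c); rewrite epq eqxx.
  apply/forall_inP => _ /imsetP[c _ ->]; apply/forall_inP => _ /imsetP[d _ ->].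
  rewrite (inj_eq g_inj); apply/implyP => cd.
  apply/forall_inP => x /colg xc; apply/forall_inP => y /colg yd.
  apply/andP; split; first by apply: contraNneq cd => xy; rewrite -xc -yd xy.
  by apply: contraNN cd => /e_col; rewrite xc yd => ->.
move=> N /andP[/forall_inP edgeN /forall_inP gapN].
have [->|[f0 f0N]] := set_0Vmem N; first by rewrite cards0.
have /existsP[x0 _] := edgeN f0 f0N.
(* The default [x0] is never taken on an edge, which is nonempty. *)
pose h (f : {set 'I_m}) := col (odflt x0 [pick x in f]).
have hE f x y : e x y -> f = [set x; y] -> h f = col x.
  move=> exy ->; rewrite /h; case: pickP => [z|/(_ x)] /=; last by rewrite !inE eqxx.
  by rewrite !inE => /orP[]/eqP -> //; rewrite (e_col exy).
rewrite -(card_in_imset (f := h) (D := N)); first exact: max_card.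
move=> f1 f2 f1N f2N; apply: contra_eq => f12.
have /existsP[x /existsP[y /andP[exy /eqP f1E]]] := edgeN f1 f1N.
have /existsP[z /existsP[w /andP[ezw /eqP f2E]]] := edgeN f2 f2N.
rewrite (hE _ _ _ exy f1E) (hE _ _ _ ezw f2E); apply/eqP => xz.
have ne u v : u \in f1 -> v \in f2 -> ~~ e u v.
  move=> uf vf; have /forall_inP/(_ f2 f2N) := gapN f1 f1N.
  by rewrite f12 => /forall_inP/(_ u uf)/forall_inP/(_ v vf)/andP[].
by case/or4P: (e_gap exy ezw xz); apply/negP; apply: ne; rewrite ?f1E ?f2E !inE eqxx ?orbT.
Qed.

End Colored.

(** * Adding disjoint edges and trimming the regularity *)

Section Assembly.
Variables (F : fieldType) (M k : nat) (e1 : rel 'I_M) (a0 : 'I_M).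
Hypotheses (s1 : symmetric e1) (i1 : irreflexive e1) (g1 : gap_free e1).

Definition vertex := ('I_M + 'I_k * bool)%type.
Let m := #|{: vertex}|.

Definition edge0 : rel vertex := fun x y =>
  match x, y with
  | inl a, inl b => e1 a b
  | inr a, inr b => (a.1 == b.1) && (a.2 != b.2)
  | _, _ => false
  end.
Let edge : rel 'I_m := fun x y => edge0 (enum_val x) (enum_val y).
Let color (x : 'I_m) : option 'I_k := if enum_val x is inr a then Some a.1 else None.
Let pairs : {set 'I_m} := [set x | color x != None].

Lemma edge_sym : symmetric edge.
Proof.
move=> x y; rewrite /edge; case: (enum_val x) (enum_val y) => [a|a] [b|b] //=.
by rewrite eq_sym (eq_sym a.2).
Qed.

Lemma edge_irrefl : irreflexive edge.
Proof. by move=> x; rewrite /edge; case: (enum_val x) => a /=; rewrite ?i1 // !eqxx andbF. Qed.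

Lemma edge_color x y : edge x y -> color x = color y.
Proof.
rewrite /edge /color; case: (enum_val x) (enum_val y) => [a|a] [b|b] //=.
by case/andP=> /eqP ->.
Qed.

Lemma edge_gap x y z w : edge x y -> edge z w -> color x = color z ->
  [|| edge x z, edge x w, edge y z | edge y w].
Proof.
rewrite /edge /color.
case: (enum_val x) (enum_val y) (enum_val z) (enum_val w) => [a|a] [b|b] [c|c] [d|d] //=.
  by move=> ab cd _; apply: g1.
move=> /andP[/eqP ab nab] /andP[/eqP cd ncd] [ac]; rewrite -cd -ab -ac !eqxx /=.
by case: (a.2) nab; case: (b.2) => //; case: (c.2) ncd; case: (d.2).
Qed.

(** The final graph is induced on a smallest [D] that keeps all added edges and regularity at least
    [n]. Its color classes are the added edges and what is left of the first part. *)
Lemma gap_free_plus_pairs n : (k < n)%N -> nonacyclic F (ind_face e1 setT) n ->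
  exists (m : nat) (e : rel 'I_m),
    [/\ symmetric e, irreflexive e, is_reg F e n & is_im e k.+1].
Proof.
move=> kn na.
(* By [hom_le] no index exceeds [m], so ranging over ['I_m.+1] loses nothing. *)
pose P (D : {set 'I_m}) := (pairs \subset D) &&
  [exists j : 'I_m.+1, (n <= j)%N && hom_in F edge D j].
have hom_le (D : {set 'I_m}) j : hom_in F edge D j -> (j <= m)%N.
  move=> hD; apply: leq_trans (_ : (#|D| <= m)%N); last first.
    by apply: leq_trans (max_card _) _; rewrite card_ord.
  by apply: (hom_in_bound edge_sym edge_irrefl) hD => u v; rewrite setDv inE.
have PT : P setT.
  pose f a : 'I_m := enum_rank (inl a : vertex).
  pose g (x : 'I_m) := if enum_val x is inl a then a else a0.
  have fK : cancel f g by move=> a; rewrite /f /g enum_rankK.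
  have fe x y : edge (f x) (f y) = e1 x y by rewrite /edge /f !enum_rankK.
  have hT : hom_in F edge setT n.
    apply/existsP; exists (f @: setT); rewrite subsetT /=.
    apply: nonacyclic_betti; first exact: ind_faceS.
    exact: nonacyclic_embed fK fe na.
  rewrite /P subsetT; apply/existsP; exists (Ordinal (hom_le _ _ hT : n < m.+1)%N).
  by rewrite leqnn.
case: (arg_minnP (fun D : {set 'I_m} => #|D|) PT) => D /andP[pD /existsP[j0 /andP[nj0 hj0]]] minD.
have [x0 [y0 [x0D y0D exy0 cx0]]] : exists x y, [/\ x \in D, y \in D, edge x y & color x = None].
  have [/exists_inP[x xD /exists_inP[y yD /andP[exy /eqP cx]]]|none] :=
    boolP [exists x in D, exists y in D, edge x y && (color x == None)].
    by exists x, y.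
  (* If no edge of the first part survived, one end of each added edge would cover all edges in [D],
     forcing [n <= k]. *)
  pose D' : {set 'I_m} := [set enum_rank (inr (i, true) : vertex) | i in 'I_k].
  have : (n <= k)%N.
    apply: leq_trans nj0 _; apply: leq_trans (_ : (#|D'| <= k)%N); last first.
      by apply: leq_trans (leq_imset_card _ _) _; rewrite card_ord.
    apply: (hom_in_bound edge_sym edge_irrefl) hj0 => u v.
    rewrite !inE => /andP[uD' uD] /andP[vD' vD]; apply/negP => euv.
    have inD' w i : enum_val w = inr (i, true) -> w \in D'.
      by move=> wE; apply/imsetP; exists i => //; rewrite -wE enum_valK.
    case uE: (enum_val u) => [a|[i b]].
      case/exists_inP: none; exists u => //; apply/exists_inP; exists v => //.
      by rewrite euv /color uE.
    move: euv; rewrite /edge uE; case vE: (enum_val v) => [//|[i' b']] /= /andP[_].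
    case: b uE => uE; first by rewrite (inD' _ _ uE) in uD'.
    by case: b' vE => // vE; rewrite (inD' _ _ vE) in vD'.
  by rewrite leqNgt kn.
(* Removing [x0] keeps the added edges, so by minimality the regularity falls below [n]; one
   deletion costs at most one, so it was at most [n] before. *)
have smaller j : hom_in F edge (D :\ x0) j -> (j < n)%N.
  move=> hj; rewrite ltnNge; apply/negP => nj.
  suff /minD : P (D :\ x0) by rewrite [X in (X <= _)%N](cardsD1 x0) x0D add1n ltnn.
  rewrite /P subsetD1 pD inE cx0 /=; apply/existsP.
  by exists (Ordinal (hom_le _ _ hj : j < m.+1)%N); rewrite nj.
have hom_n j : hom_in F edge D j -> (j <= n)%N.
  case: j => // j /(hom_in_deletion edge_sym edge_irrefl x0)/orP[] /smaller //.
  exact: ltnW.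
have j0n : j0 = n :> nat by apply/eqP; rewrite eqn_leq nj0 hom_n.
exists m, (restr edge D); split.
- exact: restr_sym edge_sym D.
- exact: restr_irrefl edge_irrefl D.
- by apply: is_reg_restr edge_sym edge_irrefl _ _ _ hom_n; rewrite -j0n.
(* The color [None] is represented by the surviving edge [x0], [y0]. *)
pose p (b : bool) (c : option 'I_k) : 'I_m :=
  if c is Some i then enum_rank (inr (i, b) : vertex) else if b then x0 else y0.
have <- : #|{: option 'I_k}| = k.+1 by rewrite card_option card_ord.
apply: (@is_im_colored m _ color (restr edge D) _ _ (p true) (p false)).
- by move=> x y /and3P[/edge_color].
- move=> x y z w /and3P[exy xD yD] /and3P[ezw zD wD] cxz.
  by rewrite /restr xD yD zD wD !andbT; apply: edge_gap.
- case=> [i|] /=; last by rewrite /restr exy0 x0D.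
  have inP b : enum_rank (inr (i, b) : vertex) \in D.
    by apply: (subsetP pD); rewrite inE /color enum_rankK.
  by rewrite /restr !inP /edge !enum_rankK /= eqxx.
by case=> [i|] //=; rewrite /color enum_rankK.
Qed.
End Assembly.

Theorem theorem1p3 (F : fieldType) (n k : nat) :
  1 <= k -> k <= n ->
  exists (m : nat) (e : rel 'I_m),
    [/\ symmetric e, irreflexive e, is_reg F e n & is_im e k].
Proof.
(* The first part accounts for one unit of the induced matching number, so one edge fewer than the
   required number is added. *)
case: k => // k _ kn; case: n kn => // n kn.
have [m [e [m0 es ei eg en]]] := gap_free_nonacyclic F n.
exact: (gap_free_plus_pairs (Ordinal m0) es ei eg kn en).
Qed.
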